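(* Let $\mathbb{B}$ be a $\mathbb{Q}$-linear subspace of $\mathbb{C}$ such that $\mathbb{C}=\mathbb{A}\oplus\mathbb{B}$ (internal direct sum of vector spaces over $\mathbb{Q}$), equipped with the subspace topology from $\mathbb{C}$. Then $\mathbb{B}$ is a transcendental group. Further, every transcendental group is algebraically isomorphic (that is, isomorphic as an abstract group) to a subgroup of $\mathbb{B}$.
   Context: $\mathbb{C}$ denotes the additive topological group of complex numbers with its euclidean topology, and $\mathbb{A}\subset\mathbb{C}$ is the field of all algebraic numbers. A transcendental group is a subgroup $G$ of the topological group $\mathbb{C}$ such that every element of $G$ except $0$ is a transcendental number. Both $\mathbb{C}$ and $\mathbb{A}$ are regarded as vector spaces over $\mathbb{Q}$; a complement $\mathbb{B}$ of $\mathbb{A}$ in $\mathbb{C}$ exists by the Axiom of Choice. *)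

(* Defs.v *)
From HB Require Import structures.
From mathcomp Require Import all_boot all_order all_algebra complex.
From mathcomp Require Import all_classical all_reals all_analysis.

Set Implicit Arguments.
Unset Strict Implicit.
Unset Printing Implicit Defensive.

Import Order.TTheory GRing.Theory Num.Theory.
Import numFieldNormedType.Exports.

Local Open Scope classical_set_scope.
Local Open Scope ring_scope.

(* [R[i]] carries no topology of its own in the libraries, and its canonical
   scalars are [R], not the rationals; this alias provides both the euclidean
   topology and the structure of a vector space over [rat]. *)
Definition Cplx (R : realType) : Type := R[i].

HB.instance Definition _ (R : realType) := Num.ClosedField.copy (Cplx R) R[i].
(* The topology of [K^o], for a numFieldType [K], has as basic neighbourhoods
   the balls of the norm of [K], here the modulus of complex numbers. *)
HB.instance Definition _ (R : realType) :=
  TopologicalZmodule.copy (Cplx R) (R[i]^o).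

Section RationalScaling.
Variable R : realType.

Let ratscale (q : rat) (z : Cplx R) : Cplx R := ratr q * z.

Let ratscaleA a b v : ratscale a (ratscale b v) = ratscale (a * b) v.
Proof. by rewrite /ratscale rmorphM mulrA. Qed.

Let ratscale1 : left_id 1 ratscale.
Proof. by move=> v; rewrite /ratscale rmorph1 mul1r. Qed.

Let ratscaleDr : right_distributive ratscale +%R.
Proof. by move=> a u v; rewrite /ratscale mulrDr. Qed.

Let ratscaleDl v : {morph ratscale^~ v : a b / a + b}.
Proof. by move=> a b; rewrite /ratscale rmorphD mulrDl. Qed.

HB.instance Definition _ := GRing.Zmodule_isLmodule.Build rat (Cplx R)
  ratscaleA ratscale1 ratscaleDr ratscaleDl.

Lemma rat_scaleE (q : rat) (z : Cplx R) : q *: z = ratr q * z.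
Proof. by []. Qed.

End RationalScaling.

Definition algebraic_number (R : realType) (z : Cplx R) : Prop :=
  algebraicOver (@ratr (Cplx R)) z.

Definition transcendental_number (R : realType) (z : Cplx R) : Prop :=
  ~ algebraic_number z.

Definition algebraic_numbers (R : realType) : set (Cplx R) :=
  [set z | algebraic_number z].
Arguments algebraic_numbers R : clear implicits.

Definition linear_subspace (F : fieldType) (V : lmodType F) (W : set V) : Prop :=
  submod_closed (mem W).

(* For linear subspaces [U] and [W]. *)
Definition internal_direct_sum (F : fieldType) (V : lmodType F) (U W : set V) :
    Prop :=
  [set u + w | u in U & w in W] = setT /\ U `&` W = [set 0].

(* A subgroup carries the subspace topology, which is determined by the
   underlying set; so subgroups are represented by their underlying sets. *)
Definition subgroup (T : topologicalZmodType) (G : set T) : Prop :=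
  zmod_closed (mem G).

Definition transcendental_group (R : realType) (G : set (Cplx R)) : Prop :=
  subgroup G /\ forall z, G z -> z <> 0 -> transcendental_number z.

(* Isomorphism of abstract groups: no continuity is required, and the values of
   [f] outside [G] are irrelevant. *)
Definition algebraically_isomorphic (S T : zmodType) (G : set S) (H : set T) :
    Prop :=
  exists f : S -> T, set_bij G H f /\ {in G &, {morph f : x y / x + y}}.

(* Main.v *)
(** The projection of C onto B along A is additive with kernel A, and a
    transcendental group meets A trivially, so it embeds into B. *)
Require Import Defs.
From HB Require Import structures.
From mathcomp Require Import all_boot all_order all_algebra complex.
From mathcomp Require Import all_classical all_reals all_analysis.
Import GRing.Theory.
Import numFieldNormedType.Exports.

Local Open Scope classical_set_scope.
Local Open Scope ring_scope.

(** [B] is transcendental because it meets the algebraic numbers only in 0. For the embedding,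
    [internal_direct_sum_projection] supplies an additive [p] into [B] with each [z - p z]
    algebraic. If [p x = p y] with [x], [y] in [G], then [x - y] is an algebraic element of [G],
    hence 0. So [p] maps [G] bijectively onto its image. *)

Lemma zmod_closed_setP {V : zmodType} {G : set V} :
  zmod_closed (mem G) <-> G 0 /\ forall x y, G x -> G y -> G (x - y).
Proof.
split=> -[G0 GB].
  split=> [|x y Gx Gy]; first exact: set_mem.
  by apply: set_mem; apply: GB; exact: mem_set.
split; first exact: mem_set.
by move=> x y /set_mem Gx /set_mem Gy; apply: mem_set; exact: GB.
Qed.

Lemma algebraic_numbers_subgroup {R : realType} :
  subgroup (algebraic_numbers R).
Proof.
apply/zmod_closed_setP; split; first exact: algebraic0.
by move=> x y; exact: algebraic_sub.
Qed.

(** Choice picks a [W]-component of each vector; additivity follows from uniqueness of the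
    decomposition, as the defect of [p] lies in both [U] and [W]. *)
Lemma internal_direct_sum_projection {F : fieldType} {V : lmodType F}
    {U W : set V} :
    zmod_closed (mem U) -> zmod_closed (mem W) -> internal_direct_sum U W ->
  exists p : V -> V,
    [/\ forall z, W (p z), forall z, U (z - p z)
      & {morph p : x y / x - y}].
Proof.
move=> /zmod_closed_setP[U0 UB] /zmod_closed_setP[W0 WB] [UWT UWI].
have /choice[p pP] (z : V) : exists w, W w /\ U (z - w).
  have : setT z by [].
  by rewrite -UWT => -[u Uu [w Ww <-]]; exists w; rewrite addrK.
have pW z := (pP z).1; have pU z := (pP z).2.
exists p; split=> // x y.
apply/subr0_eq; have : (U `&` W) (p (x - y) - (p x - p y)).
  split; last by apply: (WB) => //; exact: WB.
  (* The defect, visibly in [W], is rewritten through the [U]-components of [x], [y] and [x - y]. *)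
  have -> : p (x - y) - (p x - p y) =
      (x - p x) - (y - p y) - ((x - y) - p (x - y)).
    have -> : (x - p x) - (y - p y) = (x - y) - (p x - p y).
      by rewrite !opprD addrACA.
    by rewrite [- (x - y - p _)]opprB [RHS]addrC subrKA.
  by apply: (UB) => //; exact: UB.
by rewrite UWI.
Qed.

Theorem proposition1p4 (R : realType) (B : set (Cplx R))
    (hB : linear_subspace B)
    (hAB : internal_direct_sum (algebraic_numbers R) B) :
  transcendental_group B /\
  (forall G : set (Cplx R), transcendental_group G ->
     exists H : set (Cplx R),
       [/\ subgroup H, H `<=` B & algebraically_isomorphic G H]).
Proof.
have sB : subgroup B := GRing.submod_closedB hB.
split.
  split=> // z Bz z0 Az; apply: z0.
  have : (algebraic_numbers R `&` B) z by [].
  by rewrite hAB.2.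
move=> G [/zmod_closed_setP[G0 GB] Gtr].
have [p [pB pA pS]] := internal_direct_sum_projection
  algebraic_numbers_subgroup sB hAB.
have p0 : p 0 = 0 by rewrite -[in LHS](subrr 0) pS subrr.
have pN y : p (- y) = - p y by rewrite -sub0r pS p0 sub0r.
exists (p @` G); split.
- apply/zmod_closed_setP; split; first by exists 0.
  move=> _ _ [x Gx <-] [y Gy <-].
  by exists (x - y); [exact: GB|exact: pS].
- by move=> _ [x _ <-].
exists p; split; last by move=> x y _ _; rewrite -{1}[y]opprK pS pN opprK.
split; [by move=> x Gx; exists x| |by []].
move=> x y /set_mem Gx /set_mem Gy pxy; apply/subr0_eq.
(* A nonzero [x - y] would be transcendental, yet it equals its own algebraic component since
   [p (x - y) = 0]. *)
apply: contrapT => /(Gtr _ (GB _ _ Gx Gy)); apply.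
by have := pA (x - y); rewrite pS pxy subrr subr0.
Qed.
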